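(* Let $\mathcal{I}$ be a maximal ideal on $\mathbb{N}$. If $\delta$ is an abstract upper density with $\mathcal{Z}_\delta=\mathcal{I}$, then $\delta$ takes only the two values $0$ and $1$. In particular, there is no rich abstract upper density $\delta$ with $\mathcal{Z}_\delta=\mathcal{I}$.
   Context: An abstract upper density on $\mathbb{N}$ is a function $\delta:\mathcal{P}(\mathbb{N})\to[0,1]$ such that $\delta(\mathbb{N})=1$; $\delta(F)=0$ for every finite $F\subseteq\mathbb{N}$; $A\subseteq B$ implies $\delta(A)\le\delta(B)$; and $\delta(A\cup B)\le\delta(A)+\delta(B)$. It is rich if for every $r\in[0,1]$ there is $A\subseteq\mathbb{N}$ with $\delta(A)=r$. $\mathcal{Z}_\delta=\{A\subseteq\mathbb{N}:\delta(A)=0\}$. An ideal on $\mathbb{N}$ is a family $\mathcal{I}\subseteq\mathcal{P}(\mathbb{N})$ closed under finite unions and subsets, containing all finite subsets of $\mathbb{N}$, with $\mathbb{N}\notin\mathcal{I}$. An ideal is maximal if it is not properly contained in any other ideal on $\mathbb{N}$. *)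

(* Defs.v *)
From HB Require Import structures.
From mathcomp Require Import all_boot all_order all_algebra.
From mathcomp Require Import boolp classical_sets cardinality reals.

Set Implicit Arguments.
Unset Strict Implicit.
Unset Printing Implicit Defensive.

Import Order.TTheory GRing.Theory Num.Theory.

Local Open Scope classical_set_scope.
Local Open Scope ring_scope.

Record abstract_upper_density (R : realType) (delta : set nat -> R) : Prop :=
  AbstractUpperDensity {
    aud_ge0 : forall A, 0 <= delta A;
    aud_le1 : forall A, delta A <= 1;
    aud_setT : delta [set: nat] = 1;
    aud_finite : forall F, finite_set F -> delta F = 0;
    aud_mono : forall A B, A `<=` B -> delta A <= delta B;
    aud_setU : forall A B, delta (A `|` B) <= delta A + delta B
  }.

Definition rich (R : realType) (delta : set nat -> R) : Prop :=
  forall r : R, 0 <= r <= 1 -> exists A : set nat, delta A = r.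

Definition zero_sets (R : realType) (delta : set nat -> R) : set (set nat) :=
  [set A | delta A = 0].

(* The empty union is covered by ideal_finite. *)
Record ideal_on_nat (I : set (set nat)) : Prop := IdealOnNat {
  ideal_setU : forall A B, I A -> I B -> I (A `|` B);
  ideal_subset : forall A B, A `<=` B -> I B -> I A;
  ideal_finite : forall F, finite_set F -> I F;
  ideal_proper : ~ I [set: nat]
}.

Definition maximal_ideal_on_nat (I : set (set nat)) : Prop :=
  ideal_on_nat I /\ forall J, ideal_on_nat J -> ~ (I `<` J).

(* Main.v *)
Require Import Defs.
From mathcomp Require Import all_boot all_order all_algebra.
From mathcomp Require Import boolp classical_sets cardinality reals.
From mathcomp Require Import lra.

(** A maximal ideal contains each set or its complement. If [A] is not null,
    its complement is, so subadditivity on [A] and its complement forces the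
    density of [A] to be [1]. *)

Import Order.TTheory GRing.Theory Num.Theory.

Local Open Scope classical_set_scope.
Local Open Scope ring_scope.

(** Maximality gives the dichotomy of [maximal_ideal_setC], since otherwise adjoining [A] would
    enlarge the ideal. [density_maximal_ideal] turns it into the two values 0 and 1, which leaves no
    set of density 1/2 and so rules out richness. *)

Lemma maximal_ideal_setC (I : set (set nat)) (A : set nat) :
  maximal_ideal_on_nat I -> I A \/ I (~` A).
Proof.
move=> [[IU Isub Ifin IT] Imax].
have [?|nIA] := pselect (I A); first by left.
right; apply: contrapT => nIC.
(* [J] is the ideal generated by [I] and [A]; it is strictly larger than [I] because it contains
   [A]. *)
pose J := [set X : set nat | exists2 B, I B & X `<=` B `|` A].
apply: (Imax J).
  split.
  - move=> X Y [B IB XB] [C IC YC]; exists (B `|` C); first exact: IU.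
    by move=> x [/XB|/YC] [] ?; [left; left|right|left; right|right].
  - by move=> X Y XY [B IB YB]; exists B => // x /XY /YB.
  - by move=> F /Ifin IF; exists F => // x; left.
  (* Properness: if [B] and [A] cover all of [nat], then the complement of [A] lies inside [B],
     hence in [I]. *)
  - move=> [B IB TB]; apply: nIC; apply: Isub IB => x nAx.
    by have [] := TB x Logic.I.
split; first by move=> X IX; exists X => // x; left.
move=> JI; apply/nIA/JI; exists set0; last by move=> x; right.
exact/Ifin/finite_set0.
Qed.

Lemma density_maximal_ideal (R : realType) (delta : set nat -> R) :
  abstract_upper_density delta -> maximal_ideal_on_nat (zero_sets delta) ->
  forall A, delta A = 0 \/ delta A = 1.
Proof.
move=> [_ le1 dT _ _ dU] Zmax A.
case: (maximal_ideal_setC _ A Zmax) => [|/= dC]; first by left.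
right; apply/eqP; rewrite eq_le le1 /=.
by have := dU A (~` A); rewrite setUv dT dC addr0.
Qed.

Theorem theorem2p7 (R : realType) (I : set (set nat))
    (hI : maximal_ideal_on_nat I) :
  (forall delta : set nat -> R,
     abstract_upper_density delta -> zero_sets delta = I ->
     range delta = [set 0; 1]) /\
  ~ (exists delta : set nat -> R,
       [/\ abstract_upper_density delta, rich delta & zero_sets delta = I]).
Proof.
split=> [delta d ZI|[delta [d drich ZI]]]; rewrite -ZI in hI;
  have d01 := density_maximal_ideal _ _ d hI.
  apply/seteqP; split=> [_ [A _ <-]|_ [->|->]]; first exact: d01.
    by exists set0 => //; exact/(aud_finite d)/finite_set0.
  by exists setT => //; exact: aud_setT d.
(* Any value strictly between 0 and 1 would do. *)
have [|A dA] := drich 2^-1; first by apply/andP; split; lra.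
by have [] := d01 A; rewrite dA; lra.
Qed.
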